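(* Let $\mathbf{C}$ be a category of $\mathbf{FI}$ type. If $M_\bullet$ is a free $\mathbf{C}$-module over $\mathbb{C}$, then there exists a character polynomial $P$ on $\mathbf{C}$ whose restriction to $G_c$ coincides with the character of the $G_c$-representation $M_c$ for every object $c$. Conversely, the character polynomials arising in this way span the space of all character polynomials on $\mathbf{C}$. More precisely, for every object $d$, the character polynomials of degree $\leq d$ are exactly the characters of virtual free $\mathbf{C}$-modules of degree $\leq d$.
   Context: A category $\mathbf{C}$ is of $\mathbf{FI}$ type if: (1) all Hom-sets are finite; (2) every morphism is a monomorphism and every endomorphism is an isomorphism; (3) for all objects $c,d$ the group $G_d=\mathrm{Aut}_{\mathbf{C}}(d)$ acts transitively (by postcomposition) on $\mathrm{Hom}_{\mathbf{C}}(c,d)$; (4) for every object $d$ there are only finitely many isomorphism classes of objects $c$ with $\mathrm{Hom}_{\mathbf{C}}(c,d)\neq\emptyset$; (5) every pair of morphisms $c_1\to d\leftarrow c_2$ has a pullback, and every pair of morphisms $f_i:p\to c_i$ ($i=1,2$) has a weak push-out. A weak push-out of $f_1,f_2$ is a commutative square given by $g_i:c_i\to d$ with $g_1f_1=g_2f_2$ which is a pullback square, such that for every other pullback square $h_i:c_i\to z$ with $h_1f_1=h_2f_2$ there is a unique $h:d\to z$ with $hg_i=h_i$. Write $c\leq d$ if $\mathrm{Hom}_{\mathbf{C}}(c,d)\neq\emptyset$, and $G_c=\mathrm{Aut}_{\mathbf{C}}(c)$. A $\mathbf{C}$-module is a functor from $\mathbf{C}$ to complex vector spaces; $M_c$ is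 a $G_c$-representation. For an object $c$ and a finite-dimensional $G_c$-representation $V$, $\mathrm{Ind}_c(V)$ is the $\mathbf{C}$-module $d\mapsto \mathbb{C}[\mathrm{Hom}_{\mathbf{C}}(c,d)]\otimes_{\mathbb{C}[G_c]}V$ (with $G_c$ acting on the right by precomposition, and morphisms acting by postcomposition). A free $\mathbf{C}$-module is a finite direct sum of such induction modules; it has degree $\leq d$ if every $\mathrm{Ind}_c(V)$ appearing nontrivially has $c\leq d$. A virtual free $\mathbf{C}$-module is a formal $\mathbb{C}$-linear combination of induction modules (with $\mathrm{Ind}_c$ extended linearly to virtual representations), with degree defined in the same way. The character of a $\mathbf{C}$-module assigns to each $G_c$ the character of $M_c$. Binomial set: $\binom{d}{c}=\mathrm{Hom}_{\mathbf{C}}(c,d)/G_c$, with classes $[f]$. For a conjugacy class $\mu\subseteq G_c$ (write $|\mu|=c$), the class function $\binom{X}{\mu}$ is defined on every $G_d$ by $\binom{X}{\mu}(\sigma)=\#\{[f]\in\binom{d}{c} : \exists\psi\in\mu,\ \sigma\circ f=f\circ\psi\}$, of degree $|\mu|$. A character polynomial is a $\mathbb{C}$-linear combination of such functions; it has degree $\leq d$ if every $\binom{X}{\mu}$ appearing nontrivially has $|\mu|\leq d$. *)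

(* Defs.v *)
From HB Require Import structures.
From mathcomp Require Import all_boot all_algebra.
From mathcomp Require Import Rstruct complex.
Set Implicit Arguments. Unset Strict Implicit. Unset Printing Implicit Defensive.
Import GRing.Theory.
Local Open Scope ring_scope.

Definition CC : fieldType := (Rdefinitions.R)[i].

(* Categories with finite Hom-sets (condition (1) of FI type is built  *)
(* into the type: Hom c d is a finType).                               *)
Record category := Category {
  Ob : Type;
  Hom : Ob -> Ob -> finType;
  idm : forall c, Hom c c;
  cmp : forall a b c, Hom b c -> Hom a b -> Hom a c;
  cmp1m : forall a b (f : Hom a b), cmp (idm b) f = f;
  cmpm1 : forall a b (f : Hom a b), cmp f (idm a) = f;
  cmpA : forall a b c e (h : Hom c e) (g : Hom b c) (f : Hom a b),
      cmp h (cmp g f) = cmp (cmp h g) f }.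

Arguments Hom {_} _ _.
Arguments idm {_} _.
Arguments cmp {_ _ _ _} _ _.

Section CatDefs.
Variable C : category.

Definition isob (a b : Ob C) (f : Hom a b) : bool :=
  [exists h : Hom b a, (cmp h f == idm a) && (cmp f h == idm b)].

Definition AutC (c : Ob C) : {set Hom c c} := [set g : Hom c c | isob g].

Definition iso_obj (a b : Ob C) : Prop := exists f : Hom a b, isob f.

Definition leC (c d : Ob C) : Prop := inhabited (Hom c d).

Definition is_pullback (c1 c2 d p : Ob C) (f1 : Hom c1 d) (f2 : Hom c2 d)
    (g1 : Hom p c1) (g2 : Hom p c2) : Prop :=
  cmp f1 g1 = cmp f2 g2 /\
  forall (z : Ob C) (h1 : Hom z c1) (h2 : Hom z c2), cmp f1 h1 = cmp f2 h2 ->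
    exists! h : Hom z p, cmp g1 h = h1 /\ cmp g2 h = h2.

Definition is_weak_pushout (p c1 c2 d : Ob C) (f1 : Hom p c1) (f2 : Hom p c2)
    (g1 : Hom c1 d) (g2 : Hom c2 d) : Prop :=
  is_pullback g1 g2 f1 f2 /\
  forall (z : Ob C) (h1 : Hom c1 z) (h2 : Hom c2 z), is_pullback h1 h2 f1 f2 ->
    exists! h : Hom d z, cmp h g1 = h1 /\ cmp h g2 = h2.

Definition FI_type : Prop :=
  (forall (a b c : Ob C) (f : Hom b c) (g1 g2 : Hom a b),
      cmp f g1 = cmp f g2 -> g1 = g2) /\
  (forall (c : Ob C) (f : Hom c c), isob f) /\
  (forall (c d : Ob C) (f f' : Hom c d), exists2 g : Hom d d, g \in AutC d & cmp g f = f') /\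
  (forall d : Ob C, exists n (cs : 'I_n -> Ob C),
      forall c : Ob C, leC c d -> exists i, iso_obj c (cs i)) /\
  (forall (c1 c2 d : Ob C) (f1 : Hom c1 d) (f2 : Hom c2 d),
      exists (p : Ob C) (g1 : Hom p c1) (g2 : Hom p c2), is_pullback f1 f2 g1 g2) /\
  (forall (p c1 c2 : Ob C) (f1 : Hom p c1) (f2 : Hom p c2),
      exists (d : Ob C) (g1 : Hom c1 d) (g2 : Hom c2 d), is_weak_pushout f1 f2 g1 g2).

(* C-modules over a field F (pointwise finite dimensional: M_c = F^n,  *)
(* vectors are row vectors, a morphism f acts by v |-> v *m mact f).   *)
Variable F : fieldType.

Record Cmod := CMod {
  mdim : Ob C -> nat;
  mact : forall (c d : Ob C), Hom c d -> 'M[F]_(mdim c, mdim d);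
  mact1 : forall c, mact (idm c) = 1%:M;
  mactM : forall (a b c : Ob C) (g : Hom b c) (f : Hom a b),
      mact (cmp g f) = mact f *m mact g }.

(* finite-dimensional representations of G_c (g acts by v |-> v *m rmx g) *)
Record Grep (c : Ob C) := GRep {
  rdim : nat;
  rmx : Hom c c -> 'M[F]_rdim;
  rmx1 : rmx (idm c) = 1%:M;
  rmxM : forall g h : Hom c c, rmx (cmp g h) = rmx h *m rmx g }.

Definition cfam := forall c : Ob C, Hom c c -> F.

Definition agree (P Q : cfam) : Prop :=
  forall (c : Ob C) (g : Hom c c), g \in AutC c -> P c g = Q c g.

Definition charM (M : Cmod) : cfam := fun c g => \tr (mact M g).

(* [presents M k cobj rep]: M is isomorphic (as a C-module) to the free
   module  (+)_{i<k} Ind_{cobj i}(rep i).  Here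
   Ind_c(V)_d = F[Hom(c,d)] (x)_{F[G_c]} V, i.e. F[Hom(c,d)] (x) V modulo
   the span W_d of the e_{f o g} (x) v - e_f (x) g.v.  The isomorphism is
   given by a natural family of linear maps
      pi_d : (+)_i F[Hom(cobj i,d)] (x) V_i -> M_d,  e_f (x) v |-> v *m P i d f,
   which vanishes on W_d, is surjective, and whose kernel is exactly
   (+)_i W_{i,d}. *)
Definition presents (M : Cmod) (k : nat) (cobj : 'I_k -> Ob C)
    (rep : forall i, Grep (cobj i)) : Prop :=
  exists P : forall (i : 'I_k) (d : Ob C), Hom (cobj i) d -> 'M[F]_(rdim (rep i), mdim M d),
  [/\
      forall i (d d' : Ob C) (f : Hom (cobj i) d) (h : Hom d d'),
        P i d f *m mact M h = P i d' (cmp h f),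
      (* pi_d kills W_d *)
      forall i (d : Ob C) (f : Hom (cobj i) d) (g : Hom (cobj i) (cobj i)),
        g \in AutC (cobj i) -> P i d (cmp f g) = rmx (rep i) g *m P i d f,
      forall (d : Ob C) (v : 'rV[F]_(mdim M d)),
        exists x : forall i, Hom (cobj i) d -> 'rV[F]_(rdim (rep i)),
          v = \sum_(i < k) \sum_(f : Hom (cobj i) d) x i f *m P i d f
    & (* kernel is exactly (+)_i W_{i,d} *)
      forall (d : Ob C) (x : forall i, Hom (cobj i) d -> 'rV[F]_(rdim (rep i))),
        \sum_(i < k) \sum_(f : Hom (cobj i) d) x i f *m P i d f = 0 ->
        forall i, exists w : Hom (cobj i) d -> Hom (cobj i) (cobj i) -> 'rV[F]_(rdim (rep i)),
          forall f' : Hom (cobj i) d,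
            x i f' = \sum_(f : Hom (cobj i) d) \sum_(g in AutC (cobj i) | cmp f g == f') w f g
                     - \sum_(g in AutC (cobj i)) w f' g *m rmx (rep i) g].

Definition is_free (M : Cmod) : Prop :=
  exists k (cobj : 'I_k -> Ob C) (rep : forall i, Grep (cobj i)), @presents M k cobj rep.

Definition is_Ind (M : Cmod) (c : Ob C) (V : Grep c) : Prop :=
  @presents M 1 (fun _ => c) (fun _ => V).

Definition virt_free_char_le (d : Ob C) (chi : cfam) : Prop :=
  exists n (a : 'I_n -> F) (c : 'I_n -> Ob C) (V : forall j, Grep (c j)) (M : 'I_n -> Cmod),
    [/\ forall j, is_Ind (M j) (V j),
        forall j, a j != 0 -> (0 < rdim (V j))%N -> leC (c j) d
      & agree chi (fun e g => \sum_(j < n) a j * charM (M j) g)].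

Definition is_conj_class (c : Ob C) (mu : {set Hom c c}) : Prop :=
  exists2 psi0 : Hom c c, psi0 \in AutC c &
    mu = [set psi : Hom c c | [exists g in AutC c, cmp psi g == cmp g psi0]].

Definition binom_set (c d : Ob C) : {set {set Hom c d}} :=
  [set [set cmp f g | g in AutC c] | f : Hom c d].

Definition binomX (c : Ob C) (mu : {set Hom c c}) : cfam :=
  fun d sigma =>
    (#|[set O in binom_set c d |
         [exists f in O, [exists psi in mu, cmp sigma f == cmp f psi]]]|)%:R.

Definition charpoly_gen (deg : option (Ob C)) (chi : cfam) : Prop :=
  exists n (c : 'I_n -> Ob C) (mu : forall j, {set Hom (c j) (c j)}) (a : 'I_n -> F),
    [/\ forall j, is_conj_class (mu j),
        forall j, a j != 0 -> if deg is Some d then leC (c j) d else True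
      & agree chi (fun e sigma => \sum_(j < n) a j * binomX (mu j) sigma)].

Definition is_charpoly (chi : cfam) : Prop := charpoly_gen None chi.
Definition is_charpoly_le (d : Ob C) (chi : cfam) : Prop := charpoly_gen (Some d) chi.

End CatDefs.

(* Main.v *)
Require Import Defs.
From mathcomp Require Import all_boot all_algebra.
From mathcomp Require Import separable cyclic cyclotomic Rstruct complex.
Import Defs.
Set Implicit Arguments. Unset Strict Implicit. Unset Printing Implicit Defensive.
Import GRing.Theory.
Local Open Scope ring_scope.

(* Let N_psi(sigma) = #{f : c -> d | sigma f = f psi}.  Since G_c acts freely on
   Hom(c,d), N_psi is |C(psi)| times the binomial function of the class of psi.

   Averaging over G_c splits the projection of F[Hom(c,d)] (x) V onto
   Ind_c(V)_d, and taking the trace through this splitting gives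
   char Ind_c(V) = |G_c|^-1 sum_psi chi_V(psi) N_psi.

   Conversely, precomposition by psi is an automorphism of F[Hom(c,-)] of finite
   order n, so it decomposes F[Hom(c,-)] into eigenmodules M_j.  Each M_j is
   Ind_c of its value at c, and N_psi = sum_j z^j char M_j for a primitive n-th
   root of unity z. *)

(** * Permutation-style matrices of maps between finite sets *)

Section FunctionMatrix.
Variable F : fieldType.

Definition fun_mx (T U : finType) (phi : T -> U) : 'M[F]_(#|T|, #|U|) :=
  \matrix_(i, j) (phi (enum_val i) == enum_val j)%:R.

Lemma fun_mxE (T U : finType) (phi : T -> U) x y :
  fun_mx phi (enum_rank x) (enum_rank y) = (phi x == y)%:R.
Proof. by rewrite mxE !enum_rankK. Qed.

Lemma eq_fun_mx (T U : finType) (phi psi : T -> U) :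
  phi =1 psi -> fun_mx phi = fun_mx psi.
Proof. by move=> eq_phi; apply/matrixP=> i j; rewrite !mxE eq_phi. Qed.

Lemma fun_mx_id (T : finType) : fun_mx (@id T) = 1%:M.
Proof. by apply/matrixP=> i j; rewrite !mxE (inj_eq enum_val_inj). Qed.

Lemma fun_mxM (T U W : finType) (phi : T -> U) (psi : U -> W) :
  fun_mx phi *m fun_mx psi = fun_mx (psi \o phi).
Proof.
apply/matrixP=> i j; rewrite !mxE (bigD1 (enum_rank (phi (enum_val i)))) //=.
rewrite !mxE enum_rankK eqxx mul1r big1 ?addr0 // => k /negbTE neq_k.
rewrite !mxE; case: eqP => [eq_k|]; last by rewrite mul0r.
by rewrite eq_k enum_valK eqxx in neq_k.
Qed.

Lemma mxtrace_fun_mx (T : finType) (phi : T -> T) :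
  \tr (fun_mx phi) = #|[set x | phi x == x]|%:R.
Proof.
rewrite /mxtrace -sum1_card natr_sum [RHS]big_mkcond /=.
rewrite (reindex (@enum_rank T)) /=; last exact/onW_bij/enum_rank_bij.
by apply: eq_bigr => x _; rewrite fun_mxE inE; case: eqP.
Qed.

Lemma mul_row_fun_mx (T U : finType) (v : 'rV[F]_#|T|) (phi : T -> U) y :
  (v *m fun_mx phi) 0 (enum_rank y)
    = \sum_(x : T) v 0 (enum_rank x) * (phi x == y)%:R.
Proof.
rewrite mxE (reindex (@enum_rank T)) /=; last exact/onW_bij/enum_rank_bij.
by apply: eq_bigr => x _; rewrite fun_mxE.
Qed.

Lemma row_sum_enum_rank (T : finType) (v : 'rV[F]_#|T|) :
  v = \sum_(x : T) v 0 (enum_rank x) *: delta_mx 0 (enum_rank x).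
Proof.
rewrite {1}(row_sum_delta v) (reindex (@enum_rank T)) //.
exact/onW_bij/enum_rank_bij.
Qed.

Lemma delta_mul_fun_mx (T U : finType) (phi : T -> U) x :
  delta_mx 0 (enum_rank x) *m fun_mx phi
    = delta_mx 0 (enum_rank (phi x)) :> 'rV[F]__.
Proof.
rewrite -rowE; apply/rowP=> j; rewrite !mxE enum_rankK eqxx /=.
by rewrite -(can_eq enum_rankK) enum_valK eq_sym.
Qed.

End FunctionMatrix.

(** * Averaging over a cyclic family of operators *)

Section CyclicAverage.
Variables (F : fieldType) (N n : nat) (u : nat -> 'M[F]_N).
Hypothesis n_neq0 : n%:R != 0 :> F.
Hypothesis uM : forall k l, u k *m u l = u (k + l).
Hypothesis u_n : u n = u 0.

(** Raising the shift from k to k + 1 drops the term [u k] and adds [u (k + n)]; these agree because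
    [u n = u 0]. *)
Lemma sum_cyclic_shift k : \sum_(l < n) u (k + l) = \sum_(l < n) u l.
Proof.
case: n n_neq0 u_n => [|m _ u_m1]; first by rewrite eqxx.
elim: k => // k <-; rewrite big_ord_recr [RHS]big_ord_recl /= addrC addn0.
rewrite addSnnS -(uM k) u_m1 uM addn0; congr (_ + _).
by apply: eq_bigr => i _; rewrite addSnnS.
Qed.

(** By the cyclic shift, each of the n inner sums of the product is the full sum, and the factor n
    cancels one inverse. *)
Lemma cyclic_average_idem (e := n%:R^-1 *: \sum_(k < n) u k) : e *m e = e.
Proof.
rewrite /e -scalemxAl -scalemxAr; congr (_ *: _); rewrite mulmx_suml.
under eq_bigr => k _.
  rewrite mulmx_sumr; under eq_bigr => l _ do rewrite uM.
  rewrite sum_cyclic_shift; over.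
by rewrite sumr_const card_ord -scaler_nat scalerA mulVf // scale1r.
Qed.

End CyclicAverage.

(** * Auxiliary facts on roots of unity, sums and idempotent matrices *)

Lemma sum_prim_root_expr (F : fieldType) n (z : F) k :
  n.-primitive_root z ->
  \sum_(j < n) z ^+ (j * k) = if (n %| k)%N then n%:R else 0.
Proof.
move=> prim_z; under eq_bigr => j _ do rewrite mulnC exprM.
rewrite (prim_order_dvd prim_z); case: eqP => [-> | /eqP zk_neq1].
  under eq_bigr => j _ do rewrite expr1n.
  by rewrite sumr_const card_ord.
apply: (mulfI (x := z ^+ k - 1)); first by rewrite subr_eq0.
by rewrite mulr0 -subrX1 -exprM mulnC exprM (prim_expr_order prim_z) expr1n subrr.
Qed.

Lemma sum_pointmass_mulmx (F : fieldType) (T : finType) m n p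
    (u : 'M[F]_(m, n)) (X : T -> 'M_(n, p)) t :
  \sum_h (h == t)%:R *: u *m X h = u *m X t.
Proof.
rewrite (bigD1 t) //= eqxx scale1r big1 ?addr0 // => h /negbTE->.
by rewrite scale0r mul0mx.
Qed.

Lemma sum_tagged (V : nmodType) (I : finType) (T : I -> finType)
    (G : {i : I & T i} -> V) :
  \sum_x G x = \sum_i \sum_(t : T i) G (Tagged T t).
Proof.
rewrite (sig_big_dep _ _ (fun i (t : T i) => G (Tagged T t))) /=.
by apply: eq_big => [[i t] | [i t] _].
Qed.

(** Multiplying by [col_base e] on the left and [row_base e] on the right is injective and turns the
    claim into e e = e. *)
Lemma row_base_mul_col_base (F : fieldType) n (e : 'M[F]_n) :
  e *m e = e -> row_base e *m col_base e = 1%:M.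
Proof.
move=> e_idem; apply: (row_free_inj (row_base_free e)).
apply: (row_full_inj (col_base_full e)).
by rewrite /= mul1mx mulmx_base -mulmxA mulmx_base mulmxA mulmx_base.
Qed.

(** X^n - 1 is separable when n is nonzero in F, so it has n distinct roots, and n distinct n-th
    roots of unity include a primitive one. *)
Lemma primitive_root_exists (F : closedFieldType) n :
  n%:R != 0 :> F -> exists z : F, n.-primitive_root z.
Proof.
move=> n_neq0; have n_gt0 : (0 < n)%N.
  by rewrite lt0n; apply: contraNneq n_neq0 => ->.
have [r Dp] := closed_field_poly_normal ('X^n - 1 : {poly F}).
rewrite (monicP _) ?monicXnsubC // scale1r in Dp.
have rn1 : all n.-unity_root r by apply/allP=> z; rewrite -root_prod_XsubC -Dp.
have lt_n_r : (n < (size r).+1)%N.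
  by rewrite -(size_prod_XsubC r id) -Dp size_XnsubC.
have [|z _ prim_z] := hasP (has_prim_root n_gt0 rn1 _ lt_n_r); last by exists z.
by rewrite -separable_prod_XsubC -Dp separable_Xn_sub_1.
Qed.

(** * The groups G_c and their free right action on Hom-sets *)

Section EndomorphismsInvertible.
Variable C : category.
Hypothesis monoC : forall (a b c : Ob C) (f : Hom b c) (g1 g2 : Hom a b),
  cmp f g1 = cmp f g2 -> g1 = g2.
Hypothesis endo_iso : forall (c : Ob C) (f : Hom c c), isob f.

Lemma in_AutC (c : Ob C) (g : Hom c c) : g \in AutC c.
Proof. by rewrite inE endo_iso. Qed.

(** The default [idm c] is never reached, since [endo_iso] supplies an inverse. *)
Definition endo_inv (c : Ob C) (g : Hom c c) : Hom c c :=
  odflt (idm c) [pick h | (cmp h g == idm c) && (cmp g h == idm c)].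

Lemma endo_invP (c : Ob C) (g : Hom c c) :
  cmp (endo_inv g) g = idm c /\ cmp g (endo_inv g) = idm c.
Proof.
rewrite /endo_inv; case: pickP => [h /andP[/eqP ? /eqP ?] // | no_inv].
by have /existsP[h] := endo_iso g; rewrite no_inv.
Qed.

Lemma cmpVm (c : Ob C) (g : Hom c c) : cmp (endo_inv g) g = idm c.
Proof. by have [] := endo_invP g. Qed.

Lemma cmpmV (c : Ob C) (g : Hom c c) : cmp g (endo_inv g) = idm c.
Proof. by have [] := endo_invP g. Qed.

Lemma cmpmK (c d : Ob C) (g : Hom c c) (f : Hom c d) :
  cmp (cmp f g) (endo_inv g) = f.
Proof. by rewrite -cmpA cmpmV cmpm1. Qed.

Lemma cmpmVK (c d : Ob C) (g : Hom c c) (f : Hom c d) :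
  cmp (cmp f (endo_inv g)) g = f.
Proof. by rewrite -cmpA cmpVm cmpm1. Qed.

Lemma eq_cmp_endo (c d : Ob C) (g : Hom c c) (f f' : Hom c d) :
  (cmp f g == f') = (f == cmp f' (endo_inv g)).
Proof. by apply/eqP/eqP=> [<-|->]; rewrite ?cmpmK ?cmpmVK. Qed.

Definition conj_class (c : Ob C) (psi : Hom c c) : {set Hom c c} :=
  [set phi : Hom c c | [exists g in AutC c, cmp phi g == cmp g psi]].

Lemma conj_classP (c : Ob C) (psi : Hom c c) : is_conj_class (conj_class psi).
Proof. by exists psi => //; apply: in_AutC. Qed.

Definition centralizer (c : Ob C) (psi : Hom c c) : {set Hom c c} :=
  [set g : Hom c c | cmp psi g == cmp g psi].

Lemma centralizer_gt0 (c : Ob C) (psi : Hom c c) : (0 < #|centralizer psi|)%N.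
Proof. by apply/card_gt0P; exists (idm c); rewrite inE cmp1m cmpm1. Qed.

Definition intertwined (c d : Ob C) (psi : Hom c c) (sigma : Hom d d) :
  {set Hom c d} := [set f : Hom c d | cmp sigma f == cmp f psi].

Definition orbit (c d : Ob C) (f : Hom c d) : {set Hom c d} :=
  [set cmp f g | g in AutC c].

Lemma orbitP (c d : Ob C) (f f' : Hom c d) :
  reflect (exists g, f' = cmp f g) (f' \in orbit f).
Proof.
by apply: (iffP imsetP) => [[g _ ->]|[g ->]]; exists g => //; apply: in_AutC.
Qed.

Lemma orbit_refl (c d : Ob C) (f : Hom c d) : f \in orbit f.
Proof. by apply/orbitP; exists (idm c); rewrite cmpm1. Qed.

Lemma orbit_cmp (c d : Ob C) (f : Hom c d) g : orbit (cmp f g) = orbit f.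
Proof.
apply/setP=> f'; apply/orbitP/orbitP=> [[h ->]|[h ->]].
  by exists (cmp g h); rewrite cmpA.
by exists (cmp (endo_inv g) h); rewrite cmpA cmpmK.
Qed.

(* The centralizer of psi acts simply transitively on the intertwined morphisms
   within each orbit counted by [binomX]. *)
Lemma card_intertwined (F : fieldType) (c d : Ob C) (psi : Hom c c)
    (sigma : Hom d d) :
  #|intertwined psi sigma|%:R
    = #|centralizer psi|%:R * binomX F (conj_class psi) sigma.
Proof.
rewrite /binomX -natrM; congr _%:R.
set B := (X in (_ * #|pred_of_set X|)%N).
rewrite -sum1_card (partition_big (@orbit c d) (mem B)) /= => [|f]; last first.
  rewrite !inE => /eqP f_psi; apply/andP; split; first exact: imset_f.
  apply/existsP; exists f; rewrite orbit_refl; apply/existsP; exists psi.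
  rewrite f_psi eqxx inE andbT /=; apply/existsP; exists (idm c).
  by rewrite in_AutC cmp1m cmpm1 /=.
rewrite mulnC -sum_nat_const; apply: eq_bigr => O.
rewrite inE => /andP[/imsetP[f0 _ ->]] /existsP[_ /andP[/orbitP[g ->]]].
case/existsP=> phi /andP[]; rewrite inE => /existsP[h /andP[_ /eqP phi_h]].
(* A change of base point in the orbit: f0 g intertwines a conjugate phi of psi, and composing with
   the conjugator h makes f1 intertwine psi itself. *)
move/eqP=> sigma_fg; pose f1 := cmp (cmp f0 g) h.
have sigma_f1 : cmp sigma f1 = cmp f1 psi.
  by rewrite cmpA sigma_fg -cmpA phi_h cmpA.
(* As f1 is mono, k |-> f1 k embeds the centralizer; its image is the fibre being counted. *)
rewrite sum1dep_card -(card_imset (mem (centralizer psi)) (@monoC _ _ _ f1)).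
apply: eq_card => f; rewrite !inE; apply/andP/imsetP=> [[/eqP sigma_f /eqP Of]|].
  have /orbitP[k Dk] : f \in orbit f1.
    by rewrite !orbit_cmp; have := orbit_refl f; rewrite Of.
  exists k => //; rewrite inE; apply/eqP/(monoC (f := f1)).
  by rewrite !cmpA -sigma_f1 -cmpA -Dk.
case=> k; rewrite inE => /eqP psi_k ->; rewrite !orbit_cmp eqxx; split=> //.
by rewrite cmpA sigma_f1 -cmpA psi_k cmpA.
Qed.

Variable F : fieldType.
Hypothesis natF_neq0 : forall n, (0 < n)%N -> n%:R != 0 :> F.

Lemma card_endo_neq0 (c : Ob C) : #|Hom c c|%:R != 0 :> F.
Proof. by apply: natF_neq0; apply/card_gt0P; exists (idm c). Qed.

(** * The averaging projector onto the tensor product over F[G_c] *)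

Section AveragingOperator.
Variables (c : Ob C) (V : Grep F c) (d : Ob C).

(* Block (f, f') of the projector of F[Hom(c,d)] (x) V whose kernel is the span
   of the relations defining the tensor product over F[G_c]. *)
Definition avg_mx (f f' : Hom c d) : 'M[F]_(rdim V) :=
  #|Hom c c|%:R^-1 *: \sum_(g | cmp f' g == f) rmx V g.

Lemma avg_mx_cmp f g f' : avg_mx (cmp f g) f' = rmx V g *m avg_mx f f'.
Proof.
rewrite /avg_mx -scalemxAr mulmx_sumr; congr (_ *: _).
rewrite (reindex (cmp^~ g)) /=; last first.
  by exists (cmp^~ (endo_inv g)) => h _; rewrite ?cmpmK ?cmpmVK.
apply: eq_big => [h|h _]; last exact: rmxM.
by rewrite cmpA eq_cmp_endo cmpmK.
Qed.

(** By [avg_mx_cmp], both terms e_{fg} (x) v and e_f (x) gv of a relation have the same image under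
    the averaging matrix. *)
Lemma avg_mx_relations (x : Hom c d -> 'rV[F]_(rdim V))
    (w : Hom c d -> Hom c c -> 'rV[F]_(rdim V)) f0 :
  (forall f', x f' = \sum_f \sum_(g in AutC c | cmp f g == f') w f g
                     - \sum_(g in AutC c) w f' g *m rmx V g) ->
  \sum_f x f *m avg_mx f f0 = 0.
Proof.
move=> Dx; under eq_bigr => f' _ do rewrite Dx mulmxBl !mulmx_suml.
rewrite sumrB; apply/eqP; rewrite subr_eq0; apply/eqP.
rewrite exchange_big; apply: eq_bigr => f _ /=.
under eq_bigr => f' _ do rewrite mulmx_suml.
rewrite (exchange_big_dep (mem (AutC c))) => [|f' g _ /andP[]] //=.
apply: eq_bigr => g Gg; rewrite (big_pred1 (cmp f g)) => [|f'] /=.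
  by rewrite avg_mx_cmp mulmxA.
by rewrite Gg eq_sym.
Qed.

(** For each g exactly one f' satisfies f' g = f, and it contributes P f; the |G_c| equal terms
    cancel the normalization. *)
Lemma avg_mx_balanced m (P : Hom c d -> 'M[F]_(rdim V, m)) f :
  (forall h g, P (cmp h g) = rmx V g *m P h) ->
  \sum_f' avg_mx f f' *m P f' = P f.
Proof.
move=> PM; under eq_bigr => f' _.
  rewrite -scalemxAl mulmx_suml.
  under eq_bigr => g /eqP Df do rewrite -PM Df.
  over.
rewrite -scaler_sumr (exchange_big_dep predT) //=.
under eq_bigr => g _.
  rewrite (big_pred1 (cmp f (endo_inv g))); first over.
  by move=> f'; rewrite /= eq_cmp_endo.
by rewrite sumr_const -scaler_nat scalerA mulVf ?scale1r ?card_endo_neq0.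
Qed.

End AveragingOperator.

(** * Characters of free modules *)

(** A linear section Q of the presentation P is averaged to a section S with P S equal to the
    averaging projector. Then tr(sigma) = tr(S P sigma) is a sum over f of traces of the blocks
    (sigma f, f), where psi contributes exactly when f psi = sigma f. *)
Lemma charM_presents (M : Cmod C F) k (cobj : 'I_k -> Ob C)
    (rep : forall i, Grep F (cobj i)) (d : Ob C) (sigma : Hom d d) :
  presents M rep ->
  charM M sigma = \sum_(i < k) \sum_(psi : Hom (cobj i) (cobj i))
    #|Hom (cobj i) (cobj i)|%:R^-1 * \tr (rmx (rep i) psi)
      * #|intertwined psi sigma|%:R.
Proof.
case=> P [P_nat P_bal P_surj P_ker].
have PM i e (f : Hom (cobj i) e) g : P i e (cmp f g) = rmx (rep i) g *m P i e f.
  by apply: P_bal; apply: in_AutC.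
have /fin_all_exists[x Dx] (j : 'I_(mdim M d)) := P_surj d (delta_mx 0 j).
(* Row j of Q lifts the j-th basis vector of M_d through the surjection P. *)
pose Q i f : 'M_(mdim M d, rdim (rep i)) := \matrix_j x j i f.
have QP : \sum_i \sum_f Q i f *m P i d f = 1%:M.
  apply/row_matrixP=> j; rewrite row1 Dx raddf_sum; apply: eq_bigr => i _.
  by rewrite raddf_sum; apply: eq_bigr => f _; rewrite /= row_mul rowK.
pose S i f' := \sum_f Q i f *m avg_mx (rep i) f f'.
have SP : \sum_i \sum_f S i f *m P i d f = 1%:M.
  rewrite -QP; apply: eq_bigr => i _; rewrite /S.
  under eq_bigr => f _ do rewrite mulmx_suml.
  rewrite exchange_big; apply: eq_bigr => f _ /=.
  rewrite -(avg_mx_balanced f (PM i d)) mulmx_sumr.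
  by apply: eq_bigr => f' _; rewrite mulmxA.
have PS i f f' : P i d f *m S i f' = avg_mx (rep i) f f'.
  apply/row_matrixP=> r; rewrite row_mul; set v := row r (P i d f).
  have sum_vQ : \sum_j \sum_h v *m Q j h *m P j d h = v.
    rewrite -[RHS]mulmx1 -QP mulmx_sumr; apply: eq_bigr => j _.
    by rewrite mulmx_sumr; apply: eq_bigr => h _; rewrite mulmxA.
  (* y is the difference between the lift of v by Q and the evident lift, the r-th basis vector at f
     in component i. It lies in the kernel of P, so averaging kills it. *)
  pose y := dfwith (fun j h => v *m Q j h)
    (fun h => v *m Q i h - (h == f)%:R *: delta_mx 0 r).
  have y_i h : y i h = v *m Q i h - (h == f)%:R *: delta_mx 0 r.
    by rewrite /y dfwith_in.
  have y_ker : \sum_j \sum_h y j h *m P j d h = 0.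
    rewrite (bigD1 i) //=.
    under eq_bigr => h _ do rewrite y_i mulmxBl.
    rewrite sumrB sum_pointmass_mulmx -rowE addrAC -/v.
    apply/eqP; rewrite subr_eq0; apply/eqP.
    rewrite -[RHS]sum_vQ [RHS](bigD1 i) //=; congr (_ + _); apply: eq_bigr => j ne_ji.
    by apply: eq_bigr => h _; rewrite /y dfwith_out // eq_sym.
  have [w Dy] := P_ker d y y_ker i.
  have := avg_mx_relations f' Dy.
  under eq_bigr => h _ do rewrite y_i mulmxBl.
  rewrite sumrB sum_pointmass_mulmx -rowE => /eqP; rewrite subr_eq0 => /eqP <-.
  by rewrite mulmx_sumr; apply: eq_bigr => h _; rewrite mulmxA.
rewrite /charM -[mact M sigma]mul1mx -SP mulmx_suml raddf_sum.
apply: eq_bigr => i _; rewrite mulmx_suml raddf_sum /=.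
under eq_bigr => f _.
  rewrite -mulmxA P_nat mxtrace_mulC PS mxtraceZ raddf_sum mulr_sumr /=.
  over.
rewrite (exchange_big_dep predT) //=; apply: eq_bigr => psi _.
rewrite sumr_const mulr_natr; congr (_ *+ _).
by apply: eq_card => f; rewrite !inE eq_sym.
Qed.

(** * Representable modules and images of natural idempotents *)

Definition hom_mod (c : Ob C) : Cmod C F.
Proof.
exists (fun d => #|Hom c d|) (fun d e h => fun_mx F (fun f : Hom c d => cmp h f)).
  by move=> d; rewrite -fun_mx_id; apply: eq_fun_mx => f; apply: cmp1m.
by move=> d e e' h h'; rewrite fun_mxM; apply: eq_fun_mx => f /=; rewrite cmpA.
Defined.

Section NaturalRetract.
Variables (X : Cmod C F) (r : Ob C -> nat).
Variables (incl : forall d, 'M[F]_(r d, mdim X d)).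
Variables (proj : forall d, 'M[F]_(mdim X d, r d)).
Hypothesis inclK : forall d, incl d *m proj d = 1%:M.
Hypothesis idem_nat : forall c d (h : Hom c d),
  proj c *m incl c *m mact X h = mact X h *m (proj d *m incl d).

(** The image of the natural idempotent [proj *m incl]; naturality moves the inner idempotent past
    the first action, where [incl] absorbs it. *)
Definition retract_mod : Cmod C F.
Proof.
exists r (fun c d h => incl c *m mact X h *m proj d).
  by move=> c; rewrite mact1 mulmx1 inclK.
move=> a b c g f; rewrite mactM !mulmxA; congr (_ *m _ *m _).
rewrite -[RHS]mulmxA -[RHS]mulmxA -idem_nat.
by rewrite !mulmxA inclK mul1mx.
Defined.

Lemma charM_retract_mod d (sigma : Hom d d) :
  charM retract_mod sigma = \tr (mact X sigma *m (proj d *m incl d)).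
Proof. by rewrite /charM /= -mulmxA mxtrace_mulC -mulmxA. Qed.

Definition retract_rep (c : Ob C) : Grep F c :=
  GRep (mact1 retract_mod c) (fun g h => mactM retract_mod g h).

End NaturalRetract.

Lemma sum_cmp_endo (c d : Ob C) (g : Hom c c) (u : Hom c d) (y : Hom c d -> F) :
  \sum_f y f * (cmp f g == u)%:R = y (cmp u (endo_inv g)).
Proof.
rewrite (bigD1 (cmp u (endo_inv g))) //= cmpmVK eqxx mulr1 big1 ?addr0 // => f.
by rewrite -eq_cmp_endo => /negbTE->; rewrite mulr0.
Qed.

(* A natural idempotent of F[Hom(c,-)] is right multiplication by an idempotent
   of the group algebra F[G_c], so its image is F[Hom(c,-)] (x) (its value at c). *)
Lemma retract_hom_mod_is_Ind (c : Ob C) (r : Ob C -> nat)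
    (incl : forall d, 'M[F]_(r d, mdim (hom_mod c) d))
    (proj : forall d, 'M[F]_(mdim (hom_mod c) d, r d))
    (inclK : forall d, incl d *m proj d = 1%:M)
    (idem_nat : forall a b (h : Hom a b),
      proj a *m incl a *m mact (hom_mod c) h
        = mact (hom_mod c) h *m (proj b *m incl b)) :
  is_Ind (retract_mod inclK idem_nat) (retract_rep inclK idem_nat c).
Proof.
set M := retract_mod _ _.
have mactE a b (h : Hom a b) :
  mact M h = incl a *m mact (hom_mod c) h *m proj b by [].
exists (fun _ d f => mact M f); split.
- by move=> _ d d' f h; rewrite mactM.
- by move=> _ d f g _; rewrite mactM.
- move=> d v; pose v' := v *m incl d.
  (* Each e_f is the image of e_id under f, so the coordinates of v in F[Hom(c,d)] serve as
     coefficients of the projected e_id. *)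
  exists (fun _ f => v' 0 (enum_rank f)
                       *: (delta_mx 0 (enum_rank (idm c)) *m proj c)).
  rewrite big_ord1 -[LHS]mulmx1 -(inclK d) mulmxA.
  rewrite -/v' [v' in LHS]row_sum_enum_rank mulmx_suml; apply: eq_bigr => f _.
  rewrite -!scalemxAl; congr (_ *: _).
  rewrite mactE -!mulmxA (mulmxA (proj c)) (mulmxA (proj c *m _)) idem_nat.
  rewrite -!mulmxA inclK mulmx1.
  by rewrite mulmxA delta_mul_fun_mx cmpm1.
move=> d x; rewrite big_ord1 => x_ker i; rewrite {i}(ord1 i).
move: {x}(x ord0) x_ker => x x_ker.
pose y f := x f *m incl c.
have y_ker (u : Hom c d) :
    \sum_f \sum_k y f 0 (enum_rank k) * (cmp f k == u)%:R = 0.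
  have : \sum_f y f *m mact (hom_mod c) f = 0.
    rewrite -[RHS](mul0mx _ (incl d)) -x_ker mulmx_suml.
    apply: eq_bigr => f _; rewrite mactE -!mulmxA -idem_nat /y.
    by rewrite -!mulmxA (mulmxA (incl c) (proj c)) inclK mul1mx.
  move/rowP/(_ (enum_rank u)); rewrite summxE [RHS]mxE; apply: etrans.
  by apply: eq_bigr => f _; rewrite mul_row_fun_mx.
(* This is the kernel relation read at the point f h: substituting f g for the summation variable
   matches the solutions of g k = h with those of f g k = f h. *)
have x_avg (f : Hom c d) : \sum_g x (cmp f g) *m mact M g = 0.
  suff y_avg : \sum_g y (cmp f g) *m mact (hom_mod c) g = 0.
    under eq_bigr => g _ do rewrite mactE mulmxA mulmxA.
    by rewrite -mulmx_suml y_avg mul0mx.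
  apply/rowP=> j; rewrite -(enum_valK j); move: (enum_val j) => h {j}.
  rewrite summxE [RHS]mxE -[RHS](y_ker (cmp f h)).
  under eq_bigr => g _ do rewrite mul_row_fun_mx.
  rewrite exchange_big [RHS]exchange_big; apply: eq_bigr => k _ /=.
  rewrite (sum_cmp_endo k h (fun g => y (cmp f g) 0 (enum_rank k))).
  by rewrite (sum_cmp_endo k _ (fun g => y g 0 (enum_rank k))) cmpA.
(* With this witness the first half of the relation averages |G_c| copies of x f, and the second
   half vanishes by [x_avg]. *)
exists (fun f g => #|Hom c c|%:R^-1 *: x (cmp f g)) => f.
rewrite [X in _ - X](_ : _ = 0) ?subr0; last first.
  under eq_bigr => g _ do rewrite -scalemxAl.
  rewrite -scaler_sumr (eq_bigl predT) => [|g]; last by rewrite in_AutC.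
  by rewrite x_avg scaler0.
rewrite (exchange_big_dep (mem (AutC c))) => [|f' g _ /andP[]] //=.
rewrite (eq_bigr (fun=> #|Hom c c|%:R^-1 *: x f)) => [|g Gg]; last first.
  rewrite (big_pred1 (cmp f (endo_inv g))) ?cmpmVK // => f'.
  by rewrite Gg eq_cmp_endo.
rewrite (eq_bigl predT) => [|g]; last by rewrite in_AutC.
by rewrite sumr_const -scaler_nat scalerA mulfV ?scale1r ?card_endo_neq0.
Qed.

(** * Eigenmodules of precomposition by an automorphism *)

Section CyclicDecomposition.
Variables (c : Ob C) (a : Hom c c).

(** The orbit of the identity under left composition with a is the cyclic group generated by a, so
    this is the order of a. *)
Definition endo_order : nat := order (cmp a) (idm c).
Local Notation n := endo_order.
Definition endo_exp (k : nat) : Hom c c := iter k (cmp a) (idm c).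

Lemma endo_order_gt0 : (0 < n)%N. Proof. exact: order_gt0. Qed.

Lemma endo_exp_order : endo_exp n = idm c.
Proof. exact/iter_order/monoC. Qed.

Lemma endo_expD k l : cmp (endo_exp k) (endo_exp l) = endo_exp (k + l).
Proof. by elim: k => [|k IHk]; rewrite /= ?cmp1m // -cmpA IHk. Qed.

Lemma endo_exp1 : endo_exp 1 = a. Proof. exact: cmpm1. Qed.

Definition right_mx (k : nat) (d : Ob C) : 'M[F]_(mdim (hom_mod c) d) :=
  fun_mx F (fun f : Hom c d => cmp f (endo_exp k)).

Lemma right_mxM k l d : right_mx k d *m right_mx l d = right_mx (k + l) d.
Proof.
by rewrite fun_mxM; apply: eq_fun_mx => f /=; rewrite -cmpA endo_expD.
Qed.

Lemma right_mx_nat k d e (h : Hom d e) :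
  right_mx k d *m mact (hom_mod c) h = mact (hom_mod c) h *m right_mx k e.
Proof. by rewrite !fun_mxM; apply: eq_fun_mx => f /=; rewrite cmpA. Qed.

Lemma right_mx_order d : right_mx n d = right_mx 0 d.
Proof. by rewrite /right_mx endo_exp_order. Qed.

(** The exponent n - 1 gives the inverse of a: the trace counts f with sigma f a^-1 = f, that is,
    sigma f = f a. *)
Lemma mxtrace_right_mx d (sigma : Hom d d) :
  \tr (mact (hom_mod c) sigma *m right_mx n.-1 d) = #|intertwined a sigma|%:R.
Proof.
rewrite fun_mxM mxtrace_fun_mx; congr _%:R; apply: eq_card => f; rewrite !inE /=.
have n1 : (n.-1 + 1 = n)%N by rewrite addn1 (ltn_predK endo_order_gt0).
have an1 : cmp (endo_exp n.-1) a = idm c.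
  by rewrite -[X in cmp _ X]endo_exp1 endo_expD n1 endo_exp_order.
have a1n : cmp a (endo_exp n.-1) = idm c.
  by rewrite -[X in cmp X _]endo_exp1 endo_expD addnC n1 endo_exp_order.
apply/eqP/eqP=> [Df | ->]; last by rewrite -cmpA a1n cmpm1.
by rewrite -[X in cmp X a]Df -cmpA an1 cmpm1.
Qed.

Variables (z : F) (prim_z : n.-primitive_root z).

(* Projector onto the eigenspace of eigenvalue z^-j of precomposition by a. *)
Definition eigen_idem (j : nat) (d : Ob C) : 'M[F]_(mdim (hom_mod c) d) :=
  n%:R^-1 *: \sum_(k < n) z ^+ (j * k) *: right_mx k d.

Lemma eigen_idemK j d : eigen_idem j d *m eigen_idem j d = eigen_idem j d.
Proof.
apply: (@cyclic_average_idem _ _ _ (fun k => z ^+ (j * k) *: right_mx k d)).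
- exact/natF_neq0/endo_order_gt0.
- move=> k l; rewrite -scalemxAl -scalemxAr scalerA right_mxM.
  by rewrite -exprD mulnDr.
by rewrite right_mx_order mulnC exprM (prim_expr_order prim_z) expr1n muln0.
Qed.

Lemma eigen_idem_nat j d e (h : Hom d e) :
  eigen_idem j d *m mact (hom_mod c) h = mact (hom_mod c) h *m eigen_idem j e.
Proof.
rewrite -scalemxAl -scalemxAr mulmx_suml mulmx_sumr; congr (_ *: _).
by apply: eq_bigr => k _; rewrite -scalemxAl -scalemxAr right_mx_nat.
Qed.

(** Fourier inversion: [right_mx k] gets the coefficient n^-1 sum_j z^(j(k+1)), which is 1 for k = n
    - 1 and 0 for every other k < n. *)
Lemma sum_eigen_idem d :
  \sum_(j < n) z ^+ j *: eigen_idem j d = right_mx n.-1 d.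
Proof.
have n_gt0 := endo_order_gt0.
have lt_n1 : (n.-1 < n)%N by rewrite (ltn_predK n_gt0).
under eq_bigr => j _.
  rewrite /eigen_idem scalerA mulrC -scalerA scaler_sumr.
  under eq_bigr => k _ do rewrite scalerA -exprD -mulnS.
  over.
rewrite -scaler_sumr exchange_big /= (bigD1 (Ordinal lt_n1)) //=.
rewrite -scaler_suml sum_prim_root_expr // (ltn_predK n_gt0) dvdnn.
rewrite big1 => [|k ne_k]; last first.
  rewrite -scaler_suml sum_prim_root_expr // ifN ?scale0r //.
  apply: contraNN ne_k => /(dvdn_leq (ltn0Sn k)) le_n; apply/eqP/val_inj/eqP.
  by rewrite /= eqn_leq -ltnS (ltn_predK n_gt0) ltn_ord -ltnS (ltn_predK n_gt0).
by rewrite addr0 scalerA mulVf ?scale1r ?natF_neq0.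
Qed.

Lemma card_intertwined_is_Ind_combination :
  exists (V : 'I_n -> Grep F c) (M : 'I_n -> Cmod C F),
    (forall j, is_Ind (M j) (V j)) /\
    forall (d : Ob C) (sigma : Hom d d),
      #|intertwined a sigma|%:R = \sum_(j < n) z ^+ j * charM (M j) sigma.
Proof.
pose incl j d := row_base (eigen_idem j d).
pose proj j d := col_base (eigen_idem j d).
have inclK j d : incl j d *m proj j d = 1%:M.
  exact/row_base_mul_col_base/eigen_idemK.
have idem_nat j d e (h : Hom d e) : proj j d *m incl j d *m mact (hom_mod c) h
    = mact (hom_mod c) h *m (proj j e *m incl j e).
  by rewrite !mulmx_base eigen_idem_nat.
exists (fun j => retract_rep (inclK j) (idem_nat j) c).
exists (fun j => retract_mod (inclK j) (idem_nat j)).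
split=> [j | d sigma]; first exact: retract_hom_mod_is_Ind.
rewrite -mxtrace_right_mx -sum_eigen_idem mulmx_sumr raddf_sum /=.
apply: eq_bigr => j _; rewrite charM_retract_mod mulmx_base.
by rewrite -scalemxAr mxtraceZ.
Qed.

End CyclicDecomposition.

(** * Passage between character polynomials and virtual free modules *)

(** Allows the counts N_psi and any finite index type; the centralizer orders are absorbed into the
    coefficients. *)
Lemma charpoly_gen_fin (deg : option (Ob C)) (chi : cfam C F) (I : finType)
    (c : I -> Ob C) (psi : forall i, Hom (c i) (c i)) (a : I -> F) :
  (forall i, a i != 0 -> if deg is Some d then leC (c i) d else True) ->
  agree chi (fun d sigma => \sum_i a i * #|intertwined (psi i) sigma|%:R) ->
  charpoly_gen deg chi.
Proof.
move=> a_deg Dchi; exists #|I|, (fun j => c (enum_val j)).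
exists (fun j => conj_class (psi (enum_val j))).
exists (fun j => a (enum_val j) * #|centralizer (psi (enum_val j))|%:R).
split=> [j | j | d sigma Gsigma]; first exact: conj_classP.
  by rewrite mulf_eq0 negb_or => /andP[/a_deg].
rewrite Dchi // (reindex (@enum_val I predT)) /=; last exact/onW_bij/enum_val_bij.
by apply: eq_bigr => j _; rewrite card_intertwined mulrA.
Qed.

Lemma charpoly_gen_presents (deg : option (Ob C)) (I : finType) (a : I -> F)
    (M : I -> Cmod C F) (k : I -> nat) (cobj : forall t, 'I_(k t) -> Ob C)
    (rep : forall t i, Grep F (cobj t i)) (chi : cfam C F) :
  (forall t, presents (M t) (rep t)) ->
  (forall t i, a t != 0 -> (0 < rdim (rep t i))%N ->
     if deg is Some d then leC (cobj t i) d else True) ->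
  agree chi (fun d sigma => \sum_t a t * charM (M t) sigma) ->
  charpoly_gen deg chi.
Proof.
move=> M_rep a_deg Dchi.
pose J := {t : I & {i : 'I_(k t) & Hom (cobj t i) (cobj t i)}}.
apply: (@charpoly_gen_fin deg chi J (fun j => cobj (tag j) (tag (tagged j)))
  (fun j => tagged (tagged j))
  (fun j => a (tag j) * (#|Hom (cobj (tag j) (tag (tagged j)))
                              (cobj (tag j) (tag (tagged j)))|%:R^-1
              * \tr (rmx (rep (tag j) (tag (tagged j))) (tagged (tagged j)))))).
  move=> [t [i psi]] /=; rewrite !mulf_eq0 !negb_or => /and3P[at0 _ tr_neq0].
  (* A zero-dimensional representation has zero trace, so a nonzero coefficient forces positive
     dimension. *)
  apply: a_deg => //; rewrite lt0n; apply: contraNneq tr_neq0 => r0.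
  by rewrite /mxtrace big1 // => -[m lt_m]; exfalso; rewrite r0 in lt_m.
move=> d sigma Gsigma; rewrite Dchi //.
rewrite sum_tagged /=.
apply: eq_bigr => t _; rewrite (charM_presents _ (M_rep t)) mulr_sumr.
rewrite sum_tagged /=; apply: eq_bigr => i _; rewrite mulr_sumr.
by apply: eq_bigr => psi _; rewrite !mulrA.
Qed.

Hypothesis prim_rootF :
  forall n, (0 < n)%N -> exists z : F, n.-primitive_root z.

(** Each binomial function is N_psi over the centralizer order, and N_psi expands into eigenmodules
    induced from the same object, so the degree bound persists. *)
Lemma charpoly_gen_virtual_free (deg : option (Ob C)) (chi : cfam C F) :
  charpoly_gen deg chi ->
  exists n (a : 'I_n -> F) (c : 'I_n -> Ob C) (V : forall j, Grep F (c j))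
    (M : 'I_n -> Cmod C F),
    [/\ forall j, is_Ind (M j) (V j),
        forall j, a j != 0 -> if deg is Some d then leC (c j) d else True
      & agree chi (fun e g => \sum_(j < n) a j * charM (M j) g)].
Proof.
case=> m [c [mu [a [mu_conj a_deg Dchi]]]].
have /fin_all_exists[psi Dmu] j : exists psi, mu j = conj_class psi.
  by have [psi _ ->] := mu_conj j; exists psi.
have /fin_all_exists[z prim_z] j := prim_rootF (endo_order_gt0 (psi j)).
have /fin_all_exists[V] j := card_intertwined_is_Ind_combination (prim_z j).
case/fin_all_exists=> M M_Ind.
pose J := Finite.clone {j : 'I_m & 'I_(endo_order (psi j))} _.
pose b (x : J) : F :=
  a (tag x) / #|centralizer (psi (tag x))|%:R * z (tag x) ^+ tagged x.
exists #|J|, (fun x => b (enum_val x)), (fun x => c (tag (enum_val x))).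
exists (fun x => V _ (tagged (enum_val x))), (fun x => M _ (tagged (enum_val x))).
split=> [x | x | d sigma Gsigma]; first by have [] := M_Ind (tag (enum_val x)).
  by rewrite /b !mulf_eq0 !negb_or => /andP[/andP[/a_deg]].
transitivity (\sum_(x : J) b x * charM (M _ (tagged x)) sigma); last first.
  by rewrite (reindex (@enum_val J predT)) //; apply/onW_bij/enum_val_bij.
rewrite Dchi // sum_tagged /=; apply: eq_bigr => j _.
have [_ /(_ d sigma) card_psi] := M_Ind j.
have Cpsi_neq0 : #|centralizer (psi j)|%:R != 0 :> F.
  exact/natF_neq0/centralizer_gt0.
under eq_bigr => t _ do rewrite /b /= -mulrA.
rewrite -mulr_sumr -card_psi Dmu card_intertwined mulrA.
by rewrite divfK.
Qed.

End EndomorphismsInvertible.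

(** * The theorem over the complex numbers *)

Theorem theoremA (C : category) (hC : FI_type C) :
  (* characters of free modules are character polynomials *)
  (forall M : Cmod C CC, is_free M -> exists P : cfam C CC, is_charpoly P /\ agree P (charM M))
  /\
  (* character polynomials are spanned by characters of free modules *)
  (forall P : cfam C CC, is_charpoly P ->
     exists n (a : 'I_n -> CC) (M : 'I_n -> Cmod C CC),
       (forall j, is_free (M j)) /\
       agree P (fun e g => \sum_(j < n) a j * charM (M j) g))
  /\
  (* degree <= d: character polynomials = characters of virtual free modules *)
  (forall (d : Ob C) (chi : cfam C CC), is_charpoly_le d chi <-> virt_free_char_le d chi).
Proof.
have [monoC [endo_iso _]] := hC.
(* [CC] carries only a field structure; the order and algebraic closedness are reached through
   [Rdefinitions.R[i]]. *)
have natCC n : (0 < n)%N -> n%:R != 0 :> CC.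
  by rewrite (Num.Theory.pnatr_eq0 Rdefinitions.R[i]) -lt0n.
have prim_rootCC n : (0 < n)%N -> exists z : CC, n.-primitive_root z.
  by move/natCC; apply: (@primitive_root_exists Rdefinitions.R[i]).
have to_virtual := charpoly_gen_virtual_free monoC endo_iso natCC prim_rootCC.
have from_free := charpoly_gen_presents monoC endo_iso natCC.
split=> [M [k [cobj [rep M_rep]]] | ].
  (* The character itself is the polynomial, being a one-term combination with coefficient 1. *)
  exists (charM M); split=> //.
  apply: (from_free None 'I_1 (fun=> 1) (fun=> M) _ _ (fun=> rep)) => //.
  by move=> d g _; rewrite big_ord1 mul1r.
split=> [P /(to_virtual None)[n [a [c [V [M [M_Ind _ DP]]]]]] | d chi].
  exists n, a, M; split=> // j.
  by exists 1%N, (fun=> c j), (fun=> V j); apply: M_Ind.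
split=> [/(to_virtual (Some d))[n [a [c [V [M [M_Ind a_deg Dchi]]]]]] | ].
  by exists n, a, c, V, M; split=> // j /a_deg.
case=> n [a [c [V [M [M_Ind a_deg Dchi]]]]].
apply: (from_free (Some d) 'I_n a M (fun=> 1%N) (fun j _ => c j) (fun j _ => V j)) => //.
by move=> j _; apply: a_deg.
Qed.
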